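(* Suppose that $n=2m$ is even. Let $b$ and $\psi$ be compatible forms on the $2n$-dimensional $E$-vector space $W$, with good basis $e_1,\dots,e_{2n}$, let $W_1=\operatorname{span}_E\{e_1,\dots,e_n\}$ be the corresponding good isotropic subspace, let $\lambda=a_ia_{n+i}\in E_0$ ($1\le i\le n$), and let $D=\det(\psi|W_1)=a_1\cdots a_n$. Then: (i) There exists a conjugate linear operator $L_+\in\mathrm{End}_{E_0[G_1]}\mathrm{Res}_{E/E_0}S^+$ such that $(L_+)^2=(-1)^mD\,\mathrm{Id}$ if $m$ is even and $(L_+)^2=(-1)^mD\lambda\,\mathrm{Id}$ if $m$ is odd. (ii) There exists a conjugate linear operator $L_-\in\mathrm{End}_{E_0[G_1]}\mathrm{Res}_{E/E_0}S^-$ such that $(L_-)^2=(-1)^mD\lambda\,\mathrm{Id}$ if $m$ is even and $(L_-)^2=(-1)^mD\,\mathrm{Id}$ if $m$ is odd.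
   Context: $E_0$ is a totally real number field or $\mathbb{R}$, and $E$ is an imaginary (totally imaginary) quadratic extension of $E_0$ ($E=\mathbb{C}$ if $E_0=\mathbb{R}$); $\alpha\mapsto\bar\alpha$ is the nontrivial element of $\mathrm{Gal}(E/E_0)$. An additive map $f$ of $E$-vector spaces is conjugate linear if $f(\alpha v)=\bar\alpha f(v)$ for $\alpha\in E$. $\mathrm{Res}_{E/E_0}$ denotes Weil restriction; for an $E$-vector space it means regarding it as an $E_0$-vector space. Forms. $W$ is an $E$-vector space of dimension $2n$, $b$ a nondegenerate symmetric $E$-bilinear form and $\psi$ a nondegenerate $(E,E_0)$-Hermitian form (linear in the first variable). $b$ and $\psi$ are compatible, with good basis $e_1,\dots,e_{2n}$, if, writing $z=\sum z_ie_i$, $w=\sum w_ie_i$, we have $b(z,w)=\sum_{i=1}^n(z_iw_{n+i}+z_{n+i}w_i)$, $\psi(z,w)=\sum_{i=1}^{2n}a_iz_i\bar w_i$ with $a_i\in E_0$ nonzero, and there is $\lambda\in E_0$ with $a_ia_{n+i}=\lambda$ for all $1\le i\le n$. Then $W_1=\operatorname{span}_E\{e_1,\dots,e_n\}$ is called a good isotropic subspace. Groups. $G(W,b,\psi)$ is the algebraic group over $E_0$ given by the intersection of $\mathrm{Res}_{E/E_0}\mathrm{SO}(W,b)$ and $\mathrm{SU}(W,\psi)$. $G_1$ is the neutral component of its preimage in $\mathrm{Res}_{E/E_0}\mathrm{Spin}(W,b)$ under the double cover homomorphism; it is an algebraic group over $E_0$. $\mathrm{End}_{E_0[G_1]}$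 denotes $E_0$-linear endomorphisms commuting with $G_1$. Half spin representations. $S^+=\bigwedge^{\mathrm{even}}W_1$ and $S^-=\bigwedge^{\mathrm{odd}}W_1$ (exterior powers over $E$), with $\mathrm{Spin}(W,b)\subseteq C^{\mathrm{even}}(W,b)^*$ acting via the Clifford module structure in which $e_i$ ($i\le n$) acts by wedge product with $e_i$ and $e_{n+i}$ acts by $2$ times the interior product with the dual basis vector $e_i^*\in W_1^\vee$ (Clifford relations $e_ie_{n+i}+e_{n+i}e_i=2$, all other pairs anticommuting and $e_r^2=0$). $G_1$ acts on $S^\pm$ by restriction. *)

(* Defs.v *)
From HB Require Import structures.
From mathcomp Require Import all_boot all_order all_algebra all_field.
From mathcomp Require Import reals.

Set Implicit Arguments.
Unset Strict Implicit.
Unset Printing Implicit Defensive.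

Import GRing.Theory.
Local Open Scope ring_scope.

(* Complex embeddings of a number field have algebraic values, so they are     *)
(* the ring morphisms to [algC].                                               *)

Definition number_field (F : fieldType) : Prop :=
  exists (K : fieldExtType rat) (f : {rmorphism F -> K}), bijective f.

Definition totally_real (F : fieldType) : Prop :=
  forall (s : {rmorphism F -> algC}) (x : F), s x \is Num.real.

Definition totally_imaginary (F : fieldType) : Prop :=
  forall s : {rmorphism F -> algC}, exists x : F, s x \isn't Num.real.

Definition is_real_numbers (F : fieldType) : Prop :=
  exists (R : realType) (f : {rmorphism F -> R}), bijective f.

(* If [E0] is the field of real numbers, any quadratic extension of it is the  *)
(* field of complex numbers.                                                   *)
Definition imaginary_quadratic (E0 : fieldType) (E : fieldExtType E0) : Prop :=
  \dim {:E} = 2%N /\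
  ((number_field E0 /\ totally_real E0 /\ totally_imaginary E) \/
   is_real_numbers E0).

(* [extscal E iota] is the ring [E (x)_E0 R], for [iota : E0 -> R]: the free   *)
(* [R]-module on an [E0]-basis of [E], with the structure constants of [E].    *)

Section ScalarExtension.
Variables (E0 : fieldType) (E : fieldExtType E0).
Variables (R : comNzRingType) (iota : {rmorphism E0 -> R}).

Local Notation d := (\dim {:E}).
Local Notation vb := (vbasis {:E}).

Definition extscal : Type := let _ := iota in 'rV[R]_d.

HB.instance Definition _ := GRing.Lmodule.on extscal.

Definition ext_incl (x : E) : extscal := \row_k iota (coord vb k x).

Definition ext_mul (x y : extscal) : extscal :=
  \row_k \sum_i \sum_j x 0 i * y 0 j * iota (coord vb k (vb`_i * vb`_j)).

(* The [R]-linear extension of an [E0]-linear map. *)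
Definition ext_map (f : E -> E) (x : extscal) : extscal :=
  \row_k \sum_i x 0 i * iota (coord vb k (f vb`_i)).

Let mulm (y : extscal) : 'M[R]_d :=
  \matrix_(i, k) \sum_j y 0 j * iota (coord vb k (vb`_i * vb`_j)).

Let ext_mulE x y : ext_mul x y = x *m mulm y.
Proof.
apply/rowP=> k; rewrite !mxE; apply: eq_bigr => i _.
by rewrite mxE mulr_sumr; apply: eq_bigr => j _; rewrite mulrA.
Qed.

Let coordE (x : E) : x = \sum_i coord vb i x *: vb`_i.
Proof. by apply: coord_vbasis; rewrite memvf. Qed.

Let coord_vb (i k : 'I_d) : coord vb k vb`_i = (i == k)%:R.
Proof. by rewrite coord_free // (basis_free (vbasisP _)). Qed.

Let ext_mulC : commutative ext_mul.
Proof.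
move=> x y; apply/rowP=> k; rewrite !mxE exchange_big /=.
apply: eq_bigr => j _; apply: eq_bigr => i _.
by rewrite [x 0 i * _]mulrC [vb`_i * _]mulrC.
Qed.

Let mulmD : {morph mulm : x y / x + y}.
Proof.
move=> x y; apply/matrixP=> i k; rewrite !mxE -big_split /=.
by apply: eq_bigr => j _; rewrite mxE mulrDl.
Qed.

Let mulmM x y : mulm (ext_mul x y) = mulm x *m mulm y.
Proof.
apply/matrixP=> i k; rewrite !mxE.
have step1 (a b : 'I_d) : coord vb k (vb`_i * (vb`_a * vb`_b)) =
  \sum_l coord vb l (vb`_i * vb`_a) * coord vb k (vb`_l * vb`_b).
  rewrite mulrA {1}(coordE (vb`_i * vb`_a)) mulr_suml linear_sum /=.
  by apply: eq_bigr => l _; rewrite -scalerAl linearZ.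
have step2 (a b : 'I_d) : coord vb k (vb`_i * (vb`_a * vb`_b)) =
  \sum_j coord vb j (vb`_a * vb`_b) * coord vb k (vb`_i * vb`_j).
  rewrite {1}(coordE (vb`_a * vb`_b)) mulr_sumr linear_sum /=.
  by apply: eq_bigr => l _; rewrite -scalerAr linearZ.
transitivity (\sum_a \sum_b x 0 a * y 0 b *
    iota (coord vb k (vb`_i * (vb`_a * vb`_b)))).
  under eq_bigr => j _ do rewrite mxE mulr_suml.
  rewrite exchange_big /=; apply: eq_bigr => a _.
  under eq_bigr => j _ do rewrite mulr_suml.
  rewrite exchange_big /=; apply: eq_bigr => b _.
  rewrite step2 rmorph_sum mulr_sumr; apply: eq_bigr => j _.
  by rewrite rmorphM mulrA.
transitivity (\sum_l \sum_a \sum_b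
  (x 0 a * iota (coord vb l (vb`_i * vb`_a))) *
  (y 0 b * iota (coord vb k (vb`_l * vb`_b)))).
  rewrite [RHS]exchange_big /=; apply: eq_bigr => a _.
  rewrite [RHS]exchange_big /=; apply: eq_bigr => b _.
  rewrite step1 rmorph_sum mulr_sumr; apply: eq_bigr => l _.
  by rewrite rmorphM mulrACA.
apply: eq_bigr => l _; rewrite !mxE mulr_suml; apply: eq_bigr => a _.
by rewrite mulr_sumr.
Qed.

Let ext_mulA : associative ext_mul.
Proof. by move=> x y z; rewrite (ext_mulE x) mulmM (ext_mulE _ z) (ext_mulE x) mulmxA. Qed.

Let ext_mul1 : left_id (ext_incl 1) ext_mul.
Proof.
move=> x; rewrite ext_mulC ext_mulE -[RHS]mulmx1; congr (_ *m _).
apply/matrixP=> i k; rewrite !mxE.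
transitivity (iota (coord vb k (vb`_i * 1))); last first.
  by rewrite mulr1 coord_vb rmorph_nat.
rewrite [in RHS](coordE 1) mulr_sumr linear_sum rmorph_sum /=.
apply: eq_bigr => j _.
by rewrite mxE -scalerAr linearZ /= rmorphM.
Qed.

Let ext_mulDl : left_distributive ext_mul +%R.
Proof. by move=> x y z; rewrite !ext_mulE mulmxDl. Qed.

Let ext_1_neq0 : ext_incl 1 != 0.
Proof.
apply/eqP=> /rowP eq0; have /eqP := oner_neq0 E; apply.
rewrite (coordE 1) big1 // => k _.
by have := eq0 k; rewrite !mxE => /eqP; rewrite fmorph_eq0 => /eqP->; rewrite scale0r.
Qed.

HB.instance Definition _ := GRing.Zmodule_isComNzRing.Build extscal
  ext_mulA ext_mulC ext_mul1 ext_mulDl ext_1_neq0.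

Let ext_scaleAl (c : R) (x y : extscal) : c *: (x * y) = c *: x * y.
Proof. by rewrite /GRing.mul /= !ext_mulE -scalemxAl. Qed.

HB.instance Definition _ :=
  GRing.Lmodule_isLalgebra.Build R extscal ext_scaleAl.

End ScalarExtension.

(* Indices: [i] is [lshift n i] and [n + i] is [rshift n i], for [i : 'I_n].    *)

Record good_basis (E0 : fieldType) (E : fieldExtType E0)
    (conj : {lrmorphism E -> E}) (n : nat) (W : vectType E)
    (b : {symmetric W}) (psi : {hermitian_sym W for conj})
    (e : (n + n).-tuple W) (a : 'I_(n + n) -> E0) (lambda : E0) : Prop :=
  GoodBasis {
    gb_basis : basis_of fullv e;
    gb_sym : forall z w : 'I_(n + n) -> E,
      b (\sum_i z i *: tnth e i) (\sum_i w i *: tnth e i) =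
      \sum_(i < n) (z (lshift n i) * w (rshift n i) +
                    z (rshift n i) * w (lshift n i));
    gb_herm : forall z w : 'I_(n + n) -> E,
      psi (\sum_i z i *: tnth e i) (\sum_i w i *: tnth e i) =
      \sum_i (a i)%:A * z i * conj (w i);
    gb_neq0 : forall i, a i != 0;
    gb_lambda : forall i : 'I_n, a (lshift n i) * a (rshift n i) = lambda
  }.

Definition gram (K : fieldType) (W : vectType K) (N : nat)
    (f : W -> W -> K) (e : N.-tuple W) : 'M[K]_N :=
  \matrix_(i, j) f (tnth e i) (tnth e j).

(* Matrices act on row vectors of coordinates on the right. *)

Definition in_SO (A : comNzRingType) (N : nat) (B g : 'M[A]_N) : Prop :=
  g *m B *m g^T = B /\ \det g = 1.

Definition in_SU (A : comNzRingType) (N : nat) (cj : A -> A)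
    (H g : 'M[A]_N) : Prop :=
  g *m H *m (map_mx cj g)^T = H /\ \det g = 1.

(* The Clifford algebra of the module ['rV[A]_N] with the bilinear form of     *)
(* Gram matrix [B] is given by its universal property, with [v ^ 2 = b(v, v)]. *)

Section Clifford.
Variables (A : comNzRingType) (N : nat) (B : 'M[A]_N).

Definition clifford_map (D : algType A) (f : 'rV[A]_N -> D) : Prop :=
  forall v, f v * f v = ((v *m B *m v^T) 0 0)%:A.

Variables (C : algType A) (j : {linear 'rV[A]_N -> C}).

Definition is_clifford_algebra : Prop :=
  clifford_map j /\
  forall (D : algType A) (f : {linear 'rV[A]_N -> D}), clifford_map f ->
    exists phi : {lrmorphism C -> D},
      (forall v, phi (j v) = f v) /\
      forall phi' : {lrmorphism C -> D},
        (forall v, phi' (j v) = f v) -> phi' =1 phi.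

Inductive clifford_even : C -> Prop :=
| Even_scalar a : clifford_even a%:A
| Even_pair v w : clifford_even (j v * j w)
| Even_add x y : clifford_even x -> clifford_even y -> clifford_even (x + y)
| Even_mul x y : clifford_even x -> clifford_even y -> clifford_even (x * y).

(* The anti-automorphism that reverses products of vectors. *)
Definition is_reversal (tau : C -> C) : Prop :=
  [/\ linear tau, tau 1 = 1, forall x y, tau (x * y) = tau y * tau x
    & forall v, tau (j v) = j v].

Definition in_Spin (x : C) : Prop :=
  clifford_even x /\
  exists tau, [/\ is_reversal tau, x * tau x = 1, tau x * x = 1
                & forall v, exists w, x * j v * tau x = j w].

(* [g] is the image of [x] under the double cover: [x v x^-1 = g(v)]. *)
Definition covers (x : C) (g : 'M[A]_N) : Prop :=
  forall v, x * j v = j (v *m g) * x.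

Definition in_preimage (cj : A -> A) (H : 'M[A]_N) (x : C) : Prop :=
  in_Spin x /\ exists g, [/\ covers x g, in_SO B g & in_SU cj H g].

End Clifford.

(* Zariski topology on [V], for a class [coordinate] of functions on [V]. *)

Section Zariski.
Variables (K : fieldType) (V : Type) (coordinate : (V -> K) -> Prop).

Inductive polynomial_function : (V -> K) -> Prop :=
| Poly_const c : polynomial_function (fun _ => c)
| Poly_coordinate f : coordinate f -> polynomial_function f
| Poly_add f g : polynomial_function f -> polynomial_function g ->
    polynomial_function (fun x => f x + g x)
| Poly_mul f g : polynomial_function f -> polynomial_function g ->
    polynomial_function (fun x => f x * g x).

Definition zariski_closed (Z : V -> Prop) : Prop :=
  exists P : (V -> K) -> Prop, (forall f, P f -> polynomial_function f) /\
    forall x, Z x <-> forall f, P f -> f x = 0.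

Definition zariski_connected (Y : V -> Prop) : Prop :=
  forall Z1 Z2, zariski_closed Z1 -> zariski_closed Z2 ->
    (forall x, Y x -> Z1 x \/ Z2 x) -> (forall x, Y x -> ~ (Z1 x /\ Z2 x)) ->
    (forall x, Y x -> Z1 x) \/ (forall x, Y x -> Z2 x).

Definition zariski_component (G : V -> Prop) (x0 x : V) : Prop :=
  exists Y : V -> Prop, [/\ zariski_connected Y, forall y, Y y -> G y,
                            Y x0 & Y x].

End Zariski.

(* The exterior algebra of [W_1], over [A]: [s I] is the coefficient of the    *)
(* product of the basis vectors [e_i], [i \in I], taken in increasing order.   *)

Section Spinors.
Variable n : nat.

Definition spinor (A : comNzRingType) := {ffun {set 'I_n} -> A^o}.

Definition wedge_sign (A : comNzRingType) (i : 'I_n) (I : {set 'I_n}) : A :=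
  (-1) ^+ #|[set k in I | (k < i)%N]|.

Definition wedge (A : comNzRingType) (i : 'I_n) (s : spinor A) : spinor A :=
  [ffun I : {set 'I_n} => if i \in I then wedge_sign A i I * s (I :\ i) else 0].

Definition contract (A : comNzRingType) (i : 'I_n) (s : spinor A) : spinor A :=
  [ffun I : {set 'I_n} => if i \in I then 0 else wedge_sign A i I * s (i |: I)].

Definition is_spinor_module (A : comNzRingType) (C : algType A)
    (j : 'rV[A]_(n + n) -> C) (act : C -> spinor A -> spinor A) : Prop :=
  [/\ (forall x, linear (act x)) /\ (forall s, linear (act^~ s)),
      (forall s, act 1 s = s) /\
      (forall x y s, act (x * y) s = act x (act y s)),
      forall i s, act (j (delta_mx 0 (lshift n i))) s = wedge i s
    & forall i s, act (j (delta_mx 0 (rshift n i))) s = contract i s *+ 2].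

(* [half_spinor false] is [S^+] and [half_spinor true] is [S^-]. *)

Definition parity_set (p : bool) := {I : {set 'I_n} | odd #|I| == p}.

Definition half_spinor (p : bool) (A : comNzRingType) :=
  {ffun parity_set p -> A^o}.

Definition half_incl (p : bool) (A : comNzRingType) (s : half_spinor p A) : spinor A :=
  [ffun I : {set 'I_n} => oapp s 0 (insub I)].

Definition half_restr (p : bool) (A : comNzRingType) (s : spinor A) : half_spinor p A :=
  [ffun J => s (val J)].

(* Even elements of the Clifford algebra preserve the half spinors. *)
Definition half_act (p : bool) (A : comNzRingType) (C : algType A) (act : C -> spinor A -> spinor A)
    (x : C) (s : half_spinor p A) : half_spinor p A :=
  half_restr p (act x (half_incl s)).

End Spinors.

Section GroupG1.
Variables (E0 : fieldType) (E : fieldExtType E0) (conj : {lrmorphism E -> E}).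
Variables (n : nat) (W : vectType E).
Variables (b : {symmetric W}) (psi : {hermitian_sym W for conj}).
Variable e : (n + n).-tuple W.

Section Points.
Variables (Omega : closedFieldType) (iota : {rmorphism E0 -> Omega}).
Local Notation A := (extscal E iota).

Definition Omega_gram (f : W -> W -> E) : 'M[A]_(n + n) :=
  map_mx (ext_incl iota) (gram f e).

Variables (C : algType A) (j : {linear 'rV[A]_(n + n) -> C}).

Definition Omega_linear_form (l : C -> Omega) : Prop :=
  (forall x y, l (x + y) = l x + l y) /\
  forall (c : Omega) x, l ((c%:A : A) *: x) = c * l x.

(* The [Omega]-points of [G_1]; [C] is the Clifford algebra of [W] extended    *)
(* to [E (x) Omega].                                                           *)
Definition in_G1 (x : C) : Prop :=
  zariski_component Omega_linear_form
    (in_preimage (Omega_gram b) j (ext_map conj) (Omega_gram psi)) 1 x.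

(* The [Omega]-linear extension of an [E0]-linear endomorphism of [S^+], [S^-]. *)
Definition half_ext_map (p : bool)
    (L : half_spinor n p E -> half_spinor n p E)
    (s : half_spinor n p A) : half_spinor n p A :=
  [ffun I => \sum_(J : parity_set n p) \sum_(k < \dim {:E})
     (s J : A) 0 k *:
       ext_incl iota (L [ffun J' => (vbasis {:E})`_k *+ (J' == J)] I)].

End Points.

(* [G_1] is an algebraic group in characteristic 0, so [L] commutes with it    *)
(* iff it does so on points over algebraically closed extensions of [E0].      *)
Definition commutes_with_G1 (p : bool)
    (L : half_spinor n p E -> half_spinor n p E) : Prop :=
  forall (Omega : closedFieldType) (iota : {rmorphism E0 -> Omega})
      (C : algType (extscal E iota))
      (j : {linear 'rV[extscal E iota]_(n + n) -> C}),
    is_clifford_algebra (Omega_gram iota b) j ->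
    forall act, is_spinor_module j act ->
    forall x, in_G1 j x -> forall s : half_spinor n p (extscal E iota),
      half_ext_map L (half_act act x s) =
      half_act act x (half_ext_map L s).

End GroupG1.

(* Main.v *)
Require Import Defs.
From HB Require Import structures.
From mathcomp Require Import all_boot all_order all_algebra all_field.
From mathcomp Require Import reals.
From mathcomp Require Import ring zify.

Set Implicit Arguments.
Unset Strict Implicit.
Unset Printing Implicit Defensive.

Import GRing.Theory.
Local Open Scope ring_scope.

(* Let [phi] be the conjugate linear map of [W] with [b(z, phi w) = psi(z, w)]; *)
(* it commutes with the intersection of the orthogonal and unitary groups, and *)
(* maps [e_i] to [a_i e_(n+i)] and [e_(n+i)] to [a_(n+i) e_i].  The operator   *)
(* [L] on spinors that sends [e_I] to a suitable multiple [l] of the basis     *)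
(* vector of the complement of [I], conjugating coefficients, intertwines the  *)
(* Clifford action of [v] with that of [phi v], up to a scalar depending only  *)
(* on the parity.  Hence if [x] covers an element of the intersection then     *)
(* [x^-1 L x L^-1] commutes with the Clifford action, so it is a scalar [c].   *)
(* The form [(s, t) |-> <s, L t>], where [<,>] is the invariant bilinear form  *)
(* on spinors, is Hermitian, which gives [conj c = c]; since [L^2] is a scalar *)
(* on each half, [c * conj c = 1].  Thus [c = 1] or [c = -1], and [c = 1] on   *)
(* the neutral component by connectedness.                                     *)

(** * Operators on spinors *)

(** Everything is explicit in the basis of subsets of the [n] indices. The operator [twist]
    conjugates coefficients, passes to complements and multiplies by [twist_coef]. The intertwining
    relation is [twist_vector_act], and [twist_coefC] computes the square: it produces the sign
    (-1)^m, the product D, a power of 2 and a power of [lambda]^-1. A free normalising scalar [q]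
    then absorbs 2^n and the power of [lambda]^-1, up to one factor [lambda] that stays exactly when
    m + p is odd, for the half of parity p.

    Commutation is checked over E (x) Omega for algebraically closed Omega. The matrix of phi
    commutes with the group by [isometry_intertwines], and the commutant of the vectors is scalar by
    [vector_act_commutant]; so [twist_commutes_up_to_scalar] gives L x = c x L with c fixed by
    conjugation and c^2 = 1. As E (x) Omega is not a field, c^2 = 1 alone does not force c = 1 or c
    = -1; but [ext_map_fixed] puts c in Omega, where it does ([preimage_twist_sign]). Connectedness
    selects c = 1 in [twist_commutes_G1]. For the same reason invertibility is carried by explicit
    inverses. *)

Section LinearProperty.
Variables (A : pzRingType) (U V : lmodType A) (T : U -> V).
Hypothesis linT : linear T.

Lemma linear_prop0 : T 0 = 0.
Proof. by have := linT (-1) 0 0; rewrite scaler0 addr0 scaleN1r addNr. Qed.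

Lemma linear_propD u v : T (u + v) = T u + T v.
Proof. by have := linT 1 u v; rewrite !scale1r. Qed.

Lemma linear_propZ c u : T (c *: u) = c *: T u.
Proof. by have := linT c u 0; rewrite linear_prop0 !addr0. Qed.

End LinearProperty.

Section SpinorOperators.
Variables (n : nat) (A : comNzRingType).
Implicit Types (i : 'I_n) (I J : {set 'I_n}) (s t u : spinor n A).
Implicit Types (v w : 'rV[A]_(n + n)).

Lemma setC1U i I : ~: (i |: I) = ~: I :\ i.
Proof. by rewrite setCU setDE setIC. Qed.

Lemma setCD1 i I : ~: (I :\ i) = i |: ~: I.
Proof. by rewrite setDE setCI setCK setUC. Qed.

(** The indices below [i] are shared out between [I] and its complement, and there are [i] of them
    because indices start at 0. This is the source of every sign (-1)^i below. *)
Lemma wedge_signM i I : wedge_sign A i I * wedge_sign A i (~: I) = (-1) ^+ i.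
Proof.
rewrite /wedge_sign -exprD; congr (_ ^+ _).
transitivity #|[set k : 'I_n | (k < i)%N]|; last first.
  have widen_inj : injective (widen_ord (ltnW (ltn_ord i))).
    by move=> j k /(congr1 val) /= /val_inj.
  rewrite -[RHS]card_ord -(card_imset _ widen_inj).
  apply: eq_card => k; rewrite inE; apply/idP/imsetP => [lt_ki|[k' _ ->]].
    by exists (Ordinal lt_ki) => //; apply: val_inj.
  exact: (valP k').
rewrite -[RHS](cardsID I); congr (_ + _)%N.
  by apply: eq_card => k; rewrite !inE andbC.
by apply: eq_card => k; rewrite !inE.
Qed.

Lemma wedge_sign_sqr i I : wedge_sign A i I * wedge_sign A i I = 1.
Proof. by rewrite -expr2 sqrr_sign. Qed.

Lemma wedge_signC i I : wedge_sign A i (~: I) = (-1) ^+ i * wedge_sign A i I.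
Proof. by rewrite -(wedge_signM i I) mulrAC wedge_sign_sqr mul1r. Qed.

Lemma wedge_sign_setU1 i I : wedge_sign A i (i |: I) = wedge_sign A i I.
Proof.
congr (_ ^+ #|pred_of_set _|); apply/setP=> k; rewrite !inE.
by case: eqP => // ->; rewrite ltnn !andbF.
Qed.

Lemma wedge_is_linear i : linear (@wedge n A i).
Proof.
move=> c s t; apply/ffunP=> I; rewrite !ffunE.
by case: ifP => _; rewrite ?scaler0 ?addr0 // mulrDr; congr (_ + _); apply: mulrCA.
Qed.

Lemma contract_is_linear i : linear (@contract n A i).
Proof.
move=> c s t; apply/ffunP=> I; rewrite !ffunE.
by case: ifP => _; rewrite ?scaler0 ?addr0 // mulrDr; congr (_ + _); apply: mulrCA.
Qed.

HB.instance Definition _ i := GRing.isLinear.Build A (spinor n A) (spinor n A) *:%R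
  (@wedge n A i) (wedge_is_linear i).
HB.instance Definition _ i := GRing.isLinear.Build A (spinor n A) (spinor n A) *:%R
  (@contract n A i) (contract_is_linear i).

(** The Clifford action of vectors, written without a Clifford algebra; [act_vector] identifies it
    with any spinor module structure. *)
Definition vector_act v s : spinor n A :=
  \sum_i v 0 (lshift n i) *: wedge i s +
  \sum_i v 0 (rshift n i) *: (contract i s *+ 2).

Lemma vector_act_lshift i s : vector_act (delta_mx 0 (lshift n i)) s = wedge i s.
Proof.
rewrite /vector_act (bigD1 i) //= mxE !eqxx scale1r big1 ?addr0; last first.
  by move=> k ki; rewrite mxE eqxx /= eq_lshift (negbTE ki) scale0r.
rewrite big1 ?addr0 // => k _.
by rewrite mxE eqxx /= eq_rlshift scale0r.
Qed.

Lemma vector_act_rshift i s :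
  vector_act (delta_mx 0 (rshift n i)) s = contract i s *+ 2.
Proof.
rewrite /vector_act addrC (bigD1 i) //= mxE !eqxx scale1r big1 ?addr0; last first.
  by move=> k ki; rewrite mxE eqxx /= eq_rshift (negbTE ki) scale0r.
rewrite big1 ?addr0 // => k _.
by rewrite mxE eqxx /= eq_lrshift scale0r.
Qed.

Definition parity_scale (f : bool -> A) s : spinor n A :=
  [ffun I : {set 'I_n} => f (odd #|I|) * s I].

Lemma parity_scale_is_linear f : linear (parity_scale f).
Proof.
move=> c s t; apply/ffunP=> I; rewrite !ffunE mulrDr; congr (_ + _).
exact: mulrCA.
Qed.

HB.instance Definition _ f := GRing.isLinear.Build A (spinor n A) (spinor n A) *:%R
  (parity_scale f) (parity_scale_is_linear f).

Lemma odd_setU1 i I : i \notin I -> odd #|i |: I| = ~~ odd #|I|.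
Proof. by move=> iI; rewrite cardsU1 iI. Qed.

Lemma odd_setD1 i I : i \in I -> odd #|I :\ i| = ~~ odd #|I|.
Proof. by move=> iI; rewrite [#|I|](cardsD1 i) iI /= negbK. Qed.

Lemma wedge_parity_scale f i s :
  wedge i (parity_scale f s) = parity_scale (f \o negb) (wedge i s).
Proof.
apply/ffunP=> I; rewrite !ffunE /=; case: ifP => iI; last by rewrite mulr0.
by rewrite odd_setD1 // mulrCA.
Qed.

Lemma contract_parity_scale f i s :
  contract i (parity_scale f s) = parity_scale (f \o negb) (contract i s).
Proof.
apply/ffunP=> I; rewrite !ffunE /=; case: ifPn => iI; first by rewrite mulr0.
by rewrite odd_setU1 // mulrCA.
Qed.

Lemma vector_act_parity_scale f v s :
  vector_act v (parity_scale f s) = parity_scale (f \o negb) (vector_act v s).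
Proof.
rewrite /vector_act linearD !linear_sum; congr (_ + _); apply: eq_bigr => i _.
  by rewrite wedge_parity_scale linearZ.
by rewrite contract_parity_scale linearZ /= [parity_scale _ (_ *+ 2)]linearMn.
Qed.

Definition spinor_basis I : spinor n A := [ffun J : {set 'I_n} => (J == I)%:R].

Lemma spinor_decomp s : s = \sum_I s I *: spinor_basis I.
Proof.
apply/ffunP=> J; rewrite sum_ffunE (bigD1 J) //= big1 ?addr0.
  by rewrite !ffunE eqxx; rewrite -[RHS]/(s J * 1) mulr1.
by move=> I JI; rewrite !ffunE eq_sym (negbTE JI); apply: mulr0.
Qed.

Lemma wedge_basis i I : i \notin I ->
  wedge i (spinor_basis I) = wedge_sign A i I *: spinor_basis (i |: I).
Proof.
move=> iI; apply/ffunP=> J; rewrite !ffunE.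
rewrite -[X in _ = X]/(_ * (_ : A)).
case: (eqVneq J (i |: I)) => [->|neqJ].
  by rewrite setU11 setU1K // eqxx wedge_sign_setU1.
rewrite mulr0; case: ifP => // iJ; rewrite (_ : (_ == _) = false) ?mulr0 //.
by apply/negbTE/eqP=> eqI; rewrite -eqI setD1K ?eqxx in neqJ.
Qed.

(* The vacuum line is the common kernel of the contractions, and wedge products *)
(* of the vacuum span everything.                                             *)
Lemma vector_act_commutant (T : spinor n A -> spinor n A) (h : A) :
    h *+ 2 = 1 -> linear T ->
    (forall v s, T (vector_act v s) = vector_act v (T s)) ->
  exists c, forall s, T s = c *: s.
Proof.
move=> h2 linT comT.
have T0 := linear_prop0 linT; have TD := linear_propD linT.
have TZ := linear_propZ linT.
pose e0 := spinor_basis set0; exists (T e0 set0).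
have ce0 i : contract i e0 = 0.
  apply/ffunP=> J; rewrite !ffunE; case: ifP => // _.
  rewrite (_ : _ == _ = false) ?mulr0 //; apply/negbTE/set0Pn.
  by exists i; rewrite setU11.
have cTe0 i : contract i (T e0) = 0.
  have := comT (delta_mx 0 (rshift n i)) e0.
  rewrite !vector_act_rshift ce0 mul0rn T0 => /(congr1 ( *:%R h)).
  by rewrite scaler0 -scalerMnr scalerMnl h2 scale1r.
have Te0 : T e0 = T e0 set0 *: e0.
  apply/ffunP=> J; rewrite !ffunE.
  case: (set_0Vmem J) => [->|[i iJ]]; first by rewrite eqxx; apply/esym/mulr1.
  rewrite (_ : _ == _ = false); last by apply/negbTE/set0Pn; exists i.
  rewrite -[RHS]/(_ * 0) mulr0.
  (* Up to a sign, the coefficient of [T e0] at [J] is that of its contraction by [i] at [J] without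
     [i], which vanishes. *)
  have /ffunP/(_ (J :\ i)) := cTe0 i; rewrite !ffunE !inE eqxx /= setD1K //.
  move=> /(congr1 ( *%R (wedge_sign A i (J :\ i)))).
  by rewrite mulrA wedge_sign_sqr mul1r mulr0.
have Te I : T (spinor_basis I) = T e0 set0 *: spinor_basis I.
  have [k] := ubnP #|I|; elim: k => // k IHk in I *; rewrite ltnS => leIk.
  case: (set_0Vmem I) => [->//|[i iI]].
  have iI' : i \notin I :\ i by rewrite !inE eqxx.
  have {}IHk := IHk (I :\ i); rewrite (cardsD1 i I) iI in leIk.
  have := comT (delta_mx 0 (lshift n i)) (spinor_basis (I :\ i)).
  rewrite !vector_act_lshift IHk // linearZ /= wedge_basis // setD1K // TZ.
  move=> /(congr1 ( *:%R (wedge_sign A i (I :\ i)))).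
  rewrite !scalerA wedge_sign_sqr scale1r => ->.
  by rewrite mulrAC wedge_sign_sqr mul1r.
move=> s; rewrite {1}(spinor_decomp s).
rewrite (big_morph T TD T0); rewrite {2}(spinor_decomp s) scaler_sumr.
by apply: eq_bigr => I _; rewrite TZ Te !scalerA mulrC.
Qed.

Definition subset_sign I : A := \prod_(i in I) (-1) ^+ i.

Lemma subset_sign_setU1 i I : i \notin I ->
  subset_sign (i |: I) = (-1) ^+ i * subset_sign I.
Proof. by move=> iI; rewrite /subset_sign big_setU1. Qed.

(** The invariant form on spinors; [subset_sign] is chosen so that every vector is self-adjoint. *)
Definition spinor_pairing s t : A := \sum_I subset_sign I * s I * t (~: I).

Lemma spinor_pairingDl s1 s2 t :
  spinor_pairing (s1 + s2) t = spinor_pairing s1 t + spinor_pairing s2 t.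
Proof.
rewrite -big_split; apply: eq_bigr => I _ /=.
by rewrite ffunE mulrDr mulrDl.
Qed.

Lemma spinor_pairingDr s t1 t2 :
  spinor_pairing s (t1 + t2) = spinor_pairing s t1 + spinor_pairing s t2.
Proof. by rewrite -big_split; apply: eq_bigr => I _ /=; rewrite ffunE mulrDr. Qed.

Lemma spinor_pairingZl c s t :
  spinor_pairing (c *: s) t = c * spinor_pairing s t.
Proof.
rewrite mulr_sumr; apply: eq_bigr => I _; rewrite ffunE.
by rewrite -[X in _ * X * _]/(c * s I) mulrCA !mulrA.
Qed.

Lemma spinor_pairingZr c s t :
  spinor_pairing s (c *: t) = c * spinor_pairing s t.
Proof.
rewrite mulr_sumr; apply: eq_bigr => I _; rewrite ffunE.
by rewrite -[X in _ * _ * X]/(c * t (~: I)) mulrCA.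
Qed.

Lemma sum_set_mem i (F : {set 'I_n} -> A) :
  \sum_(I : {set 'I_n} | i \in I) F I = \sum_(J : {set 'I_n} | i \notin J) F (i |: J).
Proof.
rewrite (reindex_onto (fun J => i |: J) (fun I => I :\ i)) /=; last first.
  by move=> I iI; rewrite setD1K.
apply: eq_bigl => J; rewrite setU11 /=; apply/eqP/idP => [<-|]; last exact: setU1K.
by rewrite !inE eqxx.
Qed.

(** Both sides become sums over subsets without [i]. Adding [i] to [I] changes [subset_sign] by
    (-1)^i, and replacing [I] by its complement changes [wedge_sign] by the same factor. *)
Lemma spinor_pairing_wedge i s t :
  spinor_pairing (wedge i s) t = spinor_pairing s (wedge i t).
Proof.
rewrite /spinor_pairing (bigID (fun I : {set 'I_n} => i \in I)) /=.
rewrite [X in _ + X]big1 ?addr0; last first.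
  by move=> I /negbTE iI; rewrite ffunE iI mulr0 mul0r.
rewrite [RHS](bigID (fun I : {set 'I_n} => i \in I)) /=.
rewrite [X in _ = X + _]big1 ?add0r; last first.
  by move=> I iI; rewrite ffunE inE iI mulr0.
rewrite sum_set_mem; apply: eq_bigr => I iI.
rewrite !ffunE setU11 inE iI wedge_sign_setU1 wedge_signC subset_sign_setU1 //.
by rewrite setU1K // setC1U; ring.
Qed.

Lemma spinor_pairing_contract i s t :
  spinor_pairing (contract i s) t = spinor_pairing s (contract i t).
Proof.
rewrite /spinor_pairing (bigID (fun I : {set 'I_n} => i \in I)) /=.
rewrite [X in X + _]big1 ?add0r; last first.
  by move=> I iI; rewrite ffunE iI mulr0 mul0r.
rewrite [RHS](bigID (fun I : {set 'I_n} => i \in I)) /=.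
rewrite [X in _ = _ + X]big1 ?addr0; last first.
  by move=> I iI; rewrite ffunE inE iI mulr0.
rewrite sum_set_mem; apply: eq_bigr => I iI.
rewrite !ffunE (negbTE iI) inE setU11 /= wedge_signC wedge_sign_setU1.
rewrite subset_sign_setU1 // setC1U setD1K ?inE //.
have : (-1) ^+ i * (-1) ^+ i = 1 :> A by rewrite -expr2 sqrr_sign.
set z := (-1) ^+ i => zz; rewrite -[LHS]mul1r -zz; ring.
Qed.

Lemma spinor_pairing_vector_act v s t :
  spinor_pairing (vector_act v s) t = spinor_pairing s (vector_act v t).
Proof.
have suml (F : 'I_n -> spinor n A) u :
    spinor_pairing (\sum_i F i) u = \sum_i spinor_pairing (F i) u.
  apply: (big_morph (spinor_pairing^~ u)) => [x y|]; first exact: spinor_pairingDl.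
  by rewrite /spinor_pairing big1 // => I _; rewrite ffunE mulr0 mul0r.
have sumr (F : 'I_n -> spinor n A) u :
    spinor_pairing u (\sum_i F i) = \sum_i spinor_pairing u (F i).
  apply: (big_morph (spinor_pairing u)) => [x y|]; first exact: spinor_pairingDr.
  by rewrite /spinor_pairing big1 // => I _; rewrite ffunE mulr0.
rewrite /vector_act spinor_pairingDl spinor_pairingDr !suml !sumr.
congr (_ + _); apply: eq_bigr => i _.
  by rewrite spinor_pairingZl spinor_pairingZr spinor_pairing_wedge.
by rewrite !mulr2n spinor_pairingZl spinor_pairingZr spinor_pairingDl spinor_pairingDr
  spinor_pairing_contract.
Qed.

End SpinorOperators.

(** * The conjugate linear operator on spinors *)

Definition twist (n : nat) (A : comNzRingType) (cj : A -> A)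
    (l : {set 'I_n} -> A) (s : spinor n A) : spinor n A :=
  [ffun I => l I * cj (s (~: I))].

Section Twist.
Variables (n : nat) (A : comNzRingType) (cj : {rmorphism A -> A}).
Variables (l : {set 'I_n} -> A).
Implicit Types (i : 'I_n) (I J : {set 'I_n}) (s t u : spinor n A).
Implicit Types (v w : 'rV[A]_(n + n)).

Local Notation L := (twist cj l).

Lemma twist_is_linear : linear_for (cj \; *:%R) L.
Proof.
move=> c s t; apply/ffunP=> I; rewrite !ffunE rmorphD rmorphM mulrDr.
by congr (_ + _); apply: mulrCA.
Qed.

HB.instance Definition _ :=
  GRing.isLinear.Build A (spinor n A) (spinor n A) (cj \; *:%R) L twist_is_linear.

Lemma twistZ c s : L (c *: s) = cj c *: L s.
Proof. by rewrite linearZ. Qed.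

Variable Lam : bool -> A.
Variable al ar : 'I_n -> A.
Hypothesis twist_coef_l : forall i I, i \notin I ->
  l I = (-1) ^+ i * (al i *+ 2) * Lam (odd #|i |: I|) * l (i |: I).
Hypothesis twist_coef_r : forall i I, i \notin I ->
  (-1) ^+ i * l (i |: I) *+ 2 = ar i * Lam (odd #|I|) * l I.

Let sign2 i : (-1) ^+ i * (-1) ^+ i = 1 :> A.
Proof. by rewrite -expr2 sqrr_sign. Qed.

Let rmorph_wedge_sign i I : cj (wedge_sign A i I) = wedge_sign A i I.
Proof. exact: rmorph_sign. Qed.

(** At subsets containing [i] both sides vanish; at the others the identity is [twist_coef_l], whose
    sign (-1)^i cancels the one from [wedge_signC]. *)
Lemma twist_wedge i s :
  L (wedge i s) = al i *: (contract i (parity_scale Lam (L s)) *+ 2).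
Proof.
apply/ffunP=> I; rewrite !ffunE inE.
case: ifPn => [iI|]; last first.
  by rewrite negbK => ->; rewrite rmorph0 mulr0 addr0 scaler0.
rewrite (negbTE iI) (twist_coef_l iI) rmorphM rmorph_wedge_sign wedge_signC setC1U.
rewrite -[RHS]/(_ * _ : A); move: (sign2 i); set z := (-1) ^+ i => zz.
rewrite -[RHS]mul1r -zz; ring.
Qed.

Lemma twist_contract i s :
  L (contract i s *+ 2) = ar i *: wedge i (parity_scale Lam (L s)).
Proof.
apply/ffunP=> I; rewrite !ffunE inE.
case: ifPn => [iI|].
  by rewrite (negbTE iI) addr0 rmorph0 mulr0 scaler0.
rewrite negbK => iI; rewrite iI.
have iJ : i \notin I :\ i by rewrite !inE eqxx.
rewrite rmorphD rmorphM rmorph_wedge_sign wedge_signC setCD1.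
have := twist_coef_r iJ; rewrite setD1K // => coefE.
transitivity (wedge_sign A i I * cj (s (i |: ~: I)) *
    (ar i * Lam (odd #|I :\ i|) * l (I :\ i))).
  by rewrite -coefE; ring.
by rewrite -[RHS]/(_ * _ : A); ring.
Qed.

(** The map phi in coordinates: it sends e_i to [al i] e_(n+i) and e_(n+i) to [ar i] e_i,
    conjugating coefficients. *)
Definition vector_twist v : 'rV[A]_(n + n) :=
  row_mx (\row_i (ar i * cj (v 0 (rshift n i))))
         (\row_i (al i * cj (v 0 (lshift n i)))).

Lemma twist_vector_act v s :
  L (vector_act v s) = vector_act (vector_twist v) (parity_scale Lam (L s)).
Proof.
rewrite /vector_act linearD !linear_sum addrC; congr (_ + _); apply: eq_bigr => i _.
  by rewrite /= twistZ twist_contract row_mxEl mxE scalerA mulrC.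
by rewrite /= twistZ twist_wedge row_mxEr mxE scalerA mulrC.
Qed.

End Twist.

(** * Commutation with covering elements up to a scalar of square one *)

Section Rigidity.
Variables (n : nat) (A : comNzRingType) (cj : {rmorphism A -> A}).
Hypothesis cjK : involutive cj.
Variables (l l' : {set 'I_n} -> A) (mu Lam Lam' : bool -> A) (h : A).
Variable al ar : 'I_n -> A.
Implicit Types (I : {set 'I_n}) (s t : spinor n A).
Hypothesis n_even : ~~ odd n.
Hypothesis two_inv : h *+ 2 = 1.
Hypothesis l_real : forall I, cj (l I) = l I.
Hypothesis l_inv : forall I, l I * l' I = 1.
Hypothesis lC : forall I, l I * l (~: I) = mu (odd #|I|).
Hypothesis Lam_real : forall p, cj (Lam p) = Lam p.
Hypothesis Lam_inv : forall p, Lam p * Lam' p = 1.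
Hypothesis ar_inv : forall i, exists r, ar i * r = 1.
Hypothesis al_inv : forall i, exists r, al i * r = 1.
Hypothesis twist_coef_l : forall i I, i \notin I ->
  l I = (-1) ^+ i * (al i *+ 2) * Lam (odd #|i |: I|) * l (i |: I).
Hypothesis twist_coef_r : forall i I, i \notin I ->
  (-1) ^+ i * l (i |: I) *+ 2 = ar i * Lam (odd #|I|) * l I.

Local Notation L := (twist cj l).
Local Notation phi := (vector_twist cj al ar).
(** The inverse of [L], again conjugate linear. *)
Let Li s : spinor n A := [ffun I => l' (~: I) * cj (s (~: I))].

(** Evenness of [n] enters here: it makes [L] preserve each half. *)
Lemma odd_setC I : odd #|~: I| = odd #|I|.
Proof.
have := cardsC I; rewrite card_ord => /(congr1 odd).
by rewrite oddD (negbTE n_even); do 2!case: (odd _).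
Qed.

Let l'_real I : cj (l' I) = l' I.
Proof.
rewrite -[RHS]mul1r -(rmorph1 cj) -(l_inv I) rmorphM l_real mulrAC l_inv.
by rewrite mul1r.
Qed.

Let LiK s : L (Li s) = s.
Proof.
apply/ffunP=> I; rewrite !ffunE setCK rmorphM l'_real cjK mulrA l_inv.
exact: mul1r.
Qed.

Let LK s : Li (L s) = s.
Proof.
apply/ffunP=> I; rewrite !ffunE setCK rmorphM l_real cjK mulrA [l' _ * _]mulrC l_inv.
exact: mul1r.
Qed.

Let Li_linear : linear_for (cj \; *:%R) Li.
Proof.
move=> c s t; apply/ffunP=> I; rewrite !ffunE rmorphD rmorphM mulrDr.
by congr (_ + _); apply: mulrCA.
Qed.

Let vector_twist_surj w : exists v, phi v = w.
Proof.
have /fin_all_exists[ri ri1] := ar_inv; have /fin_all_exists[li li1] := al_inv.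
exists (row_mx (\row_i (cj (li i * w 0 (rshift n i))))
               (\row_i (cj (ri i * w 0 (lshift n i))))).
apply/rowP=> k; rewrite -(splitK k); case: (split k) => i /=.
  by rewrite row_mxEl mxE row_mxEr mxE cjK mulrA ri1 mul1r.
by rewrite row_mxEr mxE row_mxEl mxE cjK mulrA li1 mul1r.
Qed.

Lemma twist_parity_scale f s : (forall p, cj (f p) = f p) ->
  L (parity_scale f s) = parity_scale f (L s).
Proof.
move=> f_real; apply/ffunP=> I; rewrite !ffunE rmorphM f_real odd_setC.
exact: mulrCA.
Qed.

Lemma twist_sqr s : L (L s) = parity_scale mu s.
Proof.
apply/ffunP=> I; rewrite !ffunE setCK rmorphM l_real cjK mulrA lC.
by [].
Qed.

(** The complement in the pairing undoes the one in [L], so the form is diagonal in the basis of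
    subsets, with coefficients fixed by [cj]. *)
Lemma twist_hermitian s t :
  cj (spinor_pairing s (L t)) = spinor_pairing t (L s).
Proof.
rewrite rmorph_sum; apply: eq_bigr => I _; rewrite !ffunE setCK.
rewrite !rmorphM cjK l_real [cj (subset_sign _ _)]rmorph_prod.
under eq_bigr => i _ do rewrite rmorph_sign.
rewrite -/(subset_sign A I); ring.
Qed.

Variables (X X' : spinor n A -> spinor n A) (g : 'M[A]_(n + n)).
Hypothesis linX : linear X.
Hypothesis linX' : linear X'.
Hypothesis XK : forall s, X' (X s) = s.
Hypothesis X'K : forall s, X (X' s) = s.
Hypothesis X_parity : forall f s, X (parity_scale f s) = parity_scale f (X s).
Hypothesis X_adjoint : forall s t,
  spinor_pairing (X s) t = spinor_pairing s (X' t).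
Hypothesis X_covers : forall v s, X (vector_act v s) = vector_act (v *m g) (X s).
Hypothesis g_phi : forall v, phi (v *m g) = phi v *m g.

Lemma twist_commutes_up_to_scalar :
  exists c, [/\ cj c = c, c * c = 1 & forall s, L (X s) = c *: X (L s)].
Proof.
have X'_parity f s : X' (parity_scale f s) = parity_scale f (X' s).
  by rewrite -{1}(X'K s) -X_parity XK.
have X'_covers v s : X' (vector_act (v *m g) s) = vector_act v (X' s).
  by rewrite -{1}(X'K s) -X_covers XK.
have Lam_scaleK s : parity_scale Lam (parity_scale Lam' s) = s.
  by apply/ffunP=> I; rewrite !ffunE mulrA Lam_inv; exact: mul1r.
(* The two conjugations cancel, so this commutator of [X] and [L] is linear. *)
pose T s := X' (L (X (Li s))).
have linT : linear T.
  move=> c s t; rewrite /T Li_linear linX linearD linearZ /= cjK linX'.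
  by [].
have T_parity s : T (parity_scale Lam s) = parity_scale Lam (T s).
  rewrite /T -X'_parity -[in RHS]twist_parity_scale // -X_parity.
  by rewrite -{1}(LiK s) -twist_parity_scale // LK.
have T_comm v s : T (vector_act v s) = vector_act v (T s).
  (* With [v] = phi [w], each of [L] and [X] moves past the vector; phi commutes with [g], and the
     factors [Lam] cancel. *)
  have [w <-] := vector_twist_surj v.
  rewrite -{1}(Lam_scaleK s); set s' := parity_scale Lam' s.
  rewrite -{1}(LiK s') /T -(twist_vector_act cj twist_coef_l twist_coef_r) LK.
  rewrite X_covers (twist_vector_act cj twist_coef_l twist_coef_r) g_phi X'_covers.
  by rewrite X'_parity -/(T s') -T_parity Lam_scaleK.
have [c Tc] := vector_act_commutant two_inv linT T_comm.
have LX s : L (X s) = c *: X (L s).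
  have := Tc (L s); rewrite /T LK => /(congr1 X).
  by rewrite X'K (linear_propZ linX).
(* The form takes the invertible value [l setT] at ([e0], [e0]). As [X] preserves the pairing, its
   value at ([X e0], [X e0]) is [c] times that. *)
pose e0 := spinor_basis A (set0 : {set 'I_n}).
have cjc : cj c = c.
  have H0 : spinor_pairing e0 (L e0) = l setT.
    rewrite /spinor_pairing (bigD1 set0) //= big1 ?addr0.
      by rewrite /subset_sign big_set0 !ffunE setCK setC0 eqxx rmorph_nat !mulr1 mul1r.
    by move=> I /negbTE I0; rewrite !ffunE I0 mulr0 mul0r.
  have HX : spinor_pairing (X e0) (L (X e0)) = c * l setT.
    by rewrite LX spinor_pairingZr X_adjoint XK H0.
  have := twist_hermitian (X e0) (X e0); rewrite HX rmorphM l_real.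
  by move=> /(congr1 ( *%R^~ (l' setT))); rewrite -!mulrA l_inv !mulr1.
exists c; split=> //.
(* This spinor is chosen so that [X (X' e0)] has coefficient 1 at the empty set; the invertible
   [mu false] can then be cancelled. *)
have : L (L (X (X' e0))) = (c * c) *: X (L (L (X' e0))).
  by rewrite LX linearZ /= LX cjc scalerA.
rewrite !twist_sqr X_parity X'K => /ffunP/(_ set0).
rewrite !ffunE -[X in _ = X -> _]/(_ * _ : A) eqxx mulr1 -lC => eqc.
have : l' set0 * l' (~: set0) * (l set0 * l (~: set0)) = 1.
  by rewrite mulrACA ![l' _ * _]mulrC !l_inv mulr1.
by move=> unitP; rewrite -[c * c]mulr1 -{1}unitP mulrCA -eqc.
Qed.

End Rigidity.

(** * Extension of scalars *)

Section ScalarExtensionTheory.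
Variables (E0 : fieldType) (E : fieldExtType E0).
Variables (R : comNzRingType) (iota : {rmorphism E0 -> R}).

Local Notation A := (extscal E iota).
Local Notation vb := (vbasis {:E}).
Local Notation incl := (@ext_incl E0 E R iota).
Implicit Types (x y : A) (f : E -> E).

Lemma vbasis_decomp (x : E) : x = \sum_i coord vb i x *: vb`_i.
Proof. by apply: coord_vbasis; rewrite memvf. Qed.

Lemma ext_incl_is_additive : zmod_morphism incl.
Proof. by move=> x y; apply/rowP=> k; rewrite !mxE !raddfB. Qed.

HB.instance Definition _ :=
  GRing.isZmodMorphism.Build E A incl ext_incl_is_additive.

Lemma ext_incl_is_monoid_morphism : monoid_morphism incl.
Proof.
split=> // x y; apply/rowP=> k; rewrite !mxE.
rewrite {1}(vbasis_decomp x) mulr_suml linear_sum rmorph_sum; apply: eq_bigr => i _.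
rewrite {1}(vbasis_decomp y) mulr_sumr linear_sum rmorph_sum; apply: eq_bigr => j _.
by rewrite !mxE -scalerAl -scalerAr !linearZ /= !rmorphM mulrA.
Qed.

HB.instance Definition _ :=
  GRing.isMonoidMorphism.Build E A incl ext_incl_is_monoid_morphism.

Lemma ext_inclZ (a : E0) (x : E) : incl (a *: x) = iota a *: incl x.
Proof. by apply/rowP=> k; rewrite !mxE linearZ rmorphM. Qed.

Lemma extscal_decomp x : x = \sum_k (x 0 k *: incl vb`_k).
Proof.
apply/rowP=> k; rewrite summxE (bigD1 k) //= big1 ?addr0.
  by rewrite !mxE coord_free ?(basis_free (vbasisP _)) // eqxx rmorph1 mulr1.
move=> i ik; rewrite !mxE coord_free ?(basis_free (vbasisP _)) //.
by rewrite (negbTE ik) rmorph0 mulr0.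
Qed.

Lemma extscalAr (c : R) x y : x * (c *: y) = c *: (x * y).
Proof. by rewrite mulrC -scalerAl mulrC. Qed.

Lemma ext_mapE f x : ext_map f x = \sum_k (x 0 k *: incl (f vb`_k)).
Proof.
apply/rowP=> k; rewrite !mxE summxE; apply: eq_bigr => i _.
by rewrite !mxE.
Qed.

Variable conj : {lrmorphism E -> E}.
Local Notation cj := (@ext_map E0 E R iota conj).

Lemma ext_map_is_additive : zmod_morphism cj.
Proof.
move=> x y; rewrite !ext_mapE -sumrB; apply: eq_bigr => k _.
by rewrite !mxE scalerBl.
Qed.

HB.instance Definition _ :=
  GRing.isZmodMorphism.Build A A cj ext_map_is_additive.

Lemma ext_mapZ (c : R) x : cj (c *: x) = c *: cj x.
Proof.
rewrite !ext_mapE scaler_sumr; apply: eq_bigr => k _.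
by rewrite mxE scalerA.
Qed.

Lemma ext_map_incl (x : E) : cj (incl x) = incl (conj x).
Proof.
rewrite ext_mapE {2}(vbasis_decomp x) !linear_sum /= rmorph_sum.
by apply: eq_bigr => k _; rewrite mxE [conj (_ *: _)]linearZ /= ext_inclZ.
Qed.

Lemma ext_map_is_monoid_morphism : monoid_morphism cj.
Proof.
split=> [|x y].
  by rewrite -(rmorph1 incl) ext_map_incl !rmorph1.
rewrite (extscal_decomp x) (extscal_decomp y) mulr_suml !raddf_sum mulr_suml.
apply: eq_bigr => i _; rewrite !mulr_sumr raddf_sum; apply: eq_bigr => j _.
rewrite -!scalerAl !extscalAr /= !ext_mapZ -scalerAl extscalAr.
by rewrite -rmorphM !ext_map_incl !rmorphM.
Qed.

HB.instance Definition _ :=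
  GRing.isMonoidMorphism.Build A A cj ext_map_is_monoid_morphism.

Lemma ext_map_scalar (c : R) : cj c%:A = c%:A.
Proof. by rewrite ext_mapZ rmorph1. Qed.

Lemma ext_incl_scalar (a : E0) : incl a%:A = (iota a)%:A.
Proof. by rewrite ext_inclZ rmorph1. Qed.

Lemma ext_mapK : involutive conj -> involutive cj.
Proof.
move=> conjK x; rewrite {1}(extscal_decomp x) !raddf_sum {2}(extscal_decomp x).
by apply: eq_bigr => k _; rewrite /= !ext_mapZ !ext_map_incl conjK.
Qed.

End ScalarExtensionTheory.

(** * Conjugation in a quadratic extension and its fixed points after extension of scalars *)

Section QuadraticConjugation.
Variables (E0 : fieldType) (E : fieldExtType E0) (conj : {lrmorphism E -> E}).
Hypothesis E_quadratic : \dim {:E} = 2%N.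
Hypothesis conj_nontrivial : ~ conj =1 id.
Hypothesis two_neq0 : 2 != 0 :> E0.

(* An element moved by [conj] satisfies a monic quadratic equation over [E0],  *)
(* whose other root is its conjugate; completing the square gives [delta].     *)
Lemma conj_eigenbasis : exists delta : E, [/\ delta != 0, conj delta = - delta
  & forall x : E, exists p q : E0, x = p%:A + q *: delta].
Proof.
have [alpha conj_alpha] : exists alpha, conj alpha != alpha.
  have [k conj_k|conj_vb] := pickP (fun k : 'I_(\dim {:E}) =>
    conj (vbasis {:E})`_k != (vbasis {:E})`_k).
    by exists (vbasis {:E})`_k.
  case: conj_nontrivial => x.
  rewrite {2}(vbasis_decomp x) {1}(vbasis_decomp x) linear_sum.
  apply: eq_bigr => k _; rewrite linearZ /=; congr (_ *: _); apply/eqP.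
  exact: negbFE (conj_vb k).
have conjA (p : E0) : conj p%:A = p%:A by rewrite linearZ /= rmorph1.
have basis_alpha : basis_of {:E} [:: alpha; 1].
  rewrite basisEfree free_cons seq1_free oner_neq0 andbT span_seq1 subvf E_quadratic.
  rewrite /= andbT; apply/vlineP=> -[p alphaE].
  by rewrite alphaE conjA eqxx in conj_alpha.
have decomp x : exists p q : E0, x = p%:A + q *: alpha.
  have : x \in {:E}%VS by apply: memvf.
  rewrite -(span_basis basis_alpha) span_cons span_seq1.
  move=> /memv_addP[_ /vlineP[q ->] [_ /vlineP[p ->] ->]].
  by exists p, q; rewrite addrC.
have [u [t alpha2]] := decomp (alpha * alpha).
have conj_alphaE : conj alpha = t%:A - alpha.
  have := congr1 conj alpha2; rewrite rmorphM rmorphD /= conjA linearZ /=.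
  move=> conj_alpha2.
  (* [alpha] and its conjugate satisfy the same quadratic equation, which has the two roots [alpha]
     and [t - alpha]. *)
  have /eqP : (conj alpha - alpha) * (conj alpha - (t%:A - alpha)) = 0.
    transitivity ((conj alpha * conj alpha - t%:A * conj alpha)
                  - (alpha * alpha - t%:A * alpha)); first by ring.
    by rewrite conj_alpha2 alpha2 !mulr_algl !addrK subrr.
  by rewrite mulf_eq0 subr_eq0 (negbTE conj_alpha) subr_eq0 => /eqP.
have half2 : (2^-1 : E0) * 2 = 1 by rewrite mulVf.
have half_sum (x : E) : 2^-1 *: x + 2^-1 *: x = x.
  by rewrite -scalerDl -[2^-1]mulr1 -mulrDr half2 scale1r.
exists (alpha - (2^-1 * t)%:A); split.
- by apply: contra conj_alpha; rewrite subr_eq0 => /eqP->; rewrite conjA.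
- rewrite rmorphB /= conjA conj_alphaE -scalerA.
  rewrite -{1}[t%:A]half_sum; set z := _ *: _; ring.
move=> x; have [p [q ->]] := decomp x; exists (p + q * (2^-1 * t)), q.
by rewrite scalerBr scalerDl scalerA [q *: alpha - _]addrC addrA addrK.
Qed.

Lemma conjK : involutive conj.
Proof.
have [delta [_ conj_delta decomp]] := conj_eigenbasis.
move=> x; have [p [q ->]] := decomp x.
do 2!rewrite rmorphD /= !linearZZ.
by rewrite !rmorph1 conj_delta rmorphN /= conj_delta opprK.
Qed.

(** Write x = p + q delta over [K]. Being fixed means 2 q delta = 0, hence q = 0 since 2 and delta
    are invertible. *)
Lemma ext_map_fixed (K : fieldType) (iota : {rmorphism E0 -> K})
    (x : extscal E iota) : ext_map conj x = x -> exists c, x = c%:A.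
Proof.
have [delta [delta0 conj_delta decomp]] := conj_eigenbasis.
have [p [q ->]] : exists p q : K, x = p%:A + q *: ext_incl iota delta.
  have /fin_all_exists[p] (i : 'I_(\dim {:E})) := decomp (vbasis {:E})`_i.
  move=> /fin_all_exists[q decomp_vb].
  exists (\sum_i x 0 i * iota (p i)), (\sum_i x 0 i * iota (q i)).
  rewrite {1}(extscal_decomp x) !scaler_suml -big_split; apply: eq_bigr => i _ /=.
  by rewrite {1}decomp_vb raddfD /= !ext_inclZ rmorph1 scalerDr !scalerA.
rewrite raddfD /= !ext_mapZ rmorph1 ext_map_incl conj_delta rmorphN.
move=> /addrI /eqP; rewrite scalerN -subr_eq0 -opprD oppr_eq0 -mulr2n.
rewrite scalerMnl => /eqP q0; exists p.
suff -> : q = 0 by rewrite scale0r addr0.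
apply/eqP; have := congr1 ( *%R^~ (ext_incl iota delta^-1)) q0.
rewrite -scalerAl -rmorphM divff // rmorph1 mul0r.
move=> /eqP; rewrite scaler_eq0 oner_eq0 orbF -mulr_natr mulf_eq0.
by rewrite -(rmorph_nat iota) fmorph_eq0 (negbTE two_neq0) orbF.
Qed.

End QuadraticConjugation.

(** * Coefficients and half spinors *)

Section Coefficients.
Variables (E0 : fieldType) (n m : nat) (a : 'I_(n + n) -> E0) (lambda q : E0).
Hypothesis n_even : n = (2 * m)%N.
Hypothesis a_neq0 : forall i, a i != 0.
Hypothesis a_lambda : forall i : 'I_n, a (lshift n i) * a (rshift n i) = lambda.
Implicit Types (i : 'I_n) (I : {set 'I_n}).

(** The solution of the recursion [twist_coef_l], starting from the value [q] at the full set; a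
    factor [lambda]^-1 enters each time the size of the complement becomes odd. *)
Definition twist_coef I : E0 :=
  q * (\prod_(i in ~: I) ((-1) ^+ i * (a (lshift n i) *+ 2)))
    * lambda^-1 ^+ uphalf #|~: I|.

(** The two values must have product [lambda]^-1 for [twist_coef_l] and [twist_coef_r] to be
    compatible. *)
Definition parity_coef (p : bool) : E0 := lambda^-1 ^+ ~~ p.

Lemma even_n : ~~ odd n.
Proof. by rewrite n_even mul2n odd_double. Qed.

Lemma lambda_neq0 : (0 < n)%N -> lambda != 0.
Proof. by move=> n0; rewrite -(a_lambda (Ordinal n0)) mulf_neq0. Qed.

Lemma parity_coef_neq0 : (0 < n)%N -> forall p, parity_coef p != 0.
Proof. by move=> n0 p; rewrite expf_neq0 // invr_eq0 lambda_neq0. Qed.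

Lemma twist_coef_neq0 I : 2 != 0 :> E0 -> q != 0 -> twist_coef I != 0.
Proof.
move=> two_neq0 q0; rewrite !mulf_neq0 //.
  rewrite prodf_seq_neq0; apply/allP=> i _; apply/implyP=> _.
  by rewrite mulf_neq0 ?signr_eq0 // -mulr_natr mulf_neq0.
(* For [n] = 0 the scalar [lambda] may be 0, but then its exponent is 0. *)
have [n0|n0] := posnP n; last by rewrite expf_neq0 // invr_eq0 lambda_neq0.
suff -> : #|~: I| = 0%N by rewrite expr0 oner_neq0.
by apply/eqP; rewrite -leqn0 -[X in (_ <= X)%N]n0 -[X in (_ <= X)%N]card_ord max_card.
Qed.

Lemma twist_coef_l i I : i \notin I ->
  twist_coef I = (-1) ^+ i * (a (lshift n i) *+ 2)
    * parity_coef (odd #|i |: I|) * twist_coef (i |: I).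
Proof.
move=> iI; rewrite -(odd_setC even_n) /twist_coef.
have -> : ~: I = i |: ~: (i |: I) by rewrite setC1U setD1K // inE.
have iJ : i \notin ~: (i |: I) by rewrite !inE eqxx.
set J := ~: (i |: I) in iJ *.
rewrite big_setU1 //= cardsU1 iJ.
have -> : uphalf (true + #|J|) = (~~ odd #|J| + uphalf #|J|)%N.
  by rewrite uphalf_half; lia.
by rewrite exprD /parity_coef; ring.
Qed.

(** This is [twist_coef_l] multiplied by a_(n+i) and a parity factor, since a_i a_(n+i) =
    [lambda]. *)
Lemma twist_coef_r i I : i \notin I ->
  (-1) ^+ i * twist_coef (i |: I) *+ 2 =
    a (rshift n i) * parity_coef (odd #|I|) * twist_coef I.
Proof.
move=> iI; rewrite (twist_coef_l iI) odd_setU1 //.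
have lambda0 : lambda != 0 by rewrite -(a_lambda i) mulf_neq0.
have parityM p : parity_coef p * parity_coef (~~ p) = lambda^-1.
  by case: p; rewrite /parity_coef /= ?mul1r ?mulr1.
transitivity ((a (lshift n i) * a (rshift n i)) *
  (parity_coef (odd #|I|) * parity_coef (~~ odd #|I|)) *
  ((-1) ^+ i * twist_coef (i |: I) *+ 2)); last by ring.
by rewrite a_lambda parityM divff // mul1r.
Qed.

(* For [n = 0] nothing forces [lambda] to be invertible, but then there is no   *)
(* index [i].                                                                  *)
Lemma twist_coef_relations : exists Lam : bool -> E0, [/\ forall p, Lam p != 0,
    forall i I, i \notin I -> twist_coef I =
      (-1) ^+ i * (a (lshift n i) *+ 2) * Lam (odd #|i |: I|) * twist_coef (i |: I)
  & forall i I, i \notin I -> (-1) ^+ i * twist_coef (i |: I) *+ 2 =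
      a (rshift n i) * Lam (odd #|I|) * twist_coef I].
Proof.
have [n0|n0] := posnP n; last first.
  exists parity_coef; split; [exact: parity_coef_neq0 | exact: twist_coef_l |].
  exact: twist_coef_r.
exists (fun=> 1); split=> [_|i|i]; first exact: oner_neq0.
  by have := ltn_ord i; rewrite [X in (_ < X)%N]n0.
by have := ltn_ord i; rewrite [X in (_ < X)%N]n0.
Qed.

Lemma prod_sign_ord k : \prod_(i < 2 * k) (-1) ^+ i = (-1) ^+ k :> E0.
Proof.
elim: k => [|k IHk]; first by rewrite big_ord0.
rewrite mulnS !big_ord_recr /= IHk !exprS !exprM sqrrN !expr1n; ring.
Qed.

(** Each index lies in exactly one of [I] and its complement, so the products combine over all
    indices, and the signs give (-1)^m. The two sizes have sum 2m and equal parity, whence the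
    exponent of [lambda]^-1. *)
Lemma twist_coefC I : twist_coef I * twist_coef (~: I) =
  q ^+ 2 * 2 ^+ n * (-1) ^+ m * (\prod_(i < n) a (lshift n i))
    * lambda^-1 ^+ (m + odd #|I|).
Proof.
rewrite /twist_coef setCK.
have -> : (m + odd #|I|)%N = (uphalf #|~: I| + uphalf #|I|)%N.
  by have := cardsC I; have := n_even; rewrite card_ord !uphalf_half; lia.
have prodE : (\prod_(i in ~: I) ((-1) ^+ i * (a (lshift n i) *+ 2))) *
    (\prod_(i in I) ((-1) ^+ i * (a (lshift n i) *+ 2))) =
    2 ^+ n * (-1) ^+ m * \prod_(i < n) a (lshift n i).
  transitivity (\prod_i ((-1) ^+ (i : 'I_n) * (a (lshift n i) *+ 2))).
    rewrite [RHS](bigID (fun i => i \in ~: I)) /=; congr (_ * _).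
    by apply: eq_bigl => i; rewrite inE negbK.
  rewrite big_split /=; under [X in _ * X]eq_bigr => i _ do rewrite -mulr_natr.
  rewrite big_split /= prodr_const card_ord.
  have -> : \prod_(i < n) (-1) ^+ i = (-1) ^+ m :> E0.
    by rewrite n_even prod_sign_ord.
  ring.
transitivity (q ^+ 2 * (2 ^+ n * (-1) ^+ m * \prod_(i < n) a (lshift n i)) *
  lambda^-1 ^+ (uphalf #|~: I| + uphalf #|I|)); last by ring.
by rewrite -prodE exprD; ring.
Qed.

End Coefficients.

Section HalfTwist.
Variables (n : nat) (p : bool) (A : comNzRingType).
Implicit Types (u : spinor n A) (s : half_spinor n p A).

Lemma half_inclK s : half_restr p (half_incl s) = s.
Proof. by apply/ffunP=> J; rewrite !ffunE valK. Qed.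

(** The projection onto a half is a [parity_scale], so operators commuting with all [parity_scale]
    preserve the halves. *)
Lemma half_restrK u :
  half_incl (half_restr p u) = parity_scale (fun r => (r == p)%:R) u.
Proof.
apply/ffunP=> I; rewrite !ffunE.
case: insubP => [J|/negbTE] -> /=; last by rewrite mul0r.
by move=> <-; rewrite ffunE mul1r.
Qed.

Lemma half_restr_is_linear : linear (@half_restr n p A).
Proof. by move=> c s t; apply/ffunP=> J; rewrite !ffunE. Qed.

Lemma half_incl_is_linear : linear (@half_incl n p A).
Proof.
move=> c s t; apply/ffunP=> I; rewrite !ffunE.
by case: insubP => [J|] /= *; rewrite ?ffunE // scaler0 addr0.
Qed.

HB.instance Definition _ := GRing.isLinear.Build A (spinor n A)
  (half_spinor n p A) *:%R (@half_restr n p A) half_restr_is_linear.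
HB.instance Definition _ := GRing.isLinear.Build A (half_spinor n p A)
  (spinor n A) *:%R (@half_incl n p A) half_incl_is_linear.

Variables (cj : {rmorphism A -> A}) (l : {set 'I_n} -> A).

Definition half_twist s : half_spinor n p A :=
  half_restr p (twist cj l (half_incl s)).

Lemma half_twist_is_linear : linear_for (cj \; *:%R) half_twist.
Proof. by move=> c s t; rewrite /half_twist !linearD !linearZ. Qed.

HB.instance Definition _ := GRing.isLinear.Build A (half_spinor n p A)
  (half_spinor n p A) (cj \; *:%R) half_twist half_twist_is_linear.

Hypothesis n_even : ~~ odd n.

Lemma half_incl_twist s :
  half_incl (half_twist s) = twist cj l (half_incl s).
Proof.
rewrite half_restrK -(twist_parity_scale l n_even); last by move=> r; rewrite rmorph_nat.
by rewrite -half_restrK half_inclK.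
Qed.

Lemma half_twist_sqr mu s : involutive cj -> (forall I, cj (l I) = l I) ->
    (forall I, l I * l (~: I) = mu (odd #|I|)) ->
  half_twist (half_twist s) = mu p *: s.
Proof.
move=> cjK l_real lC; rewrite {1}/half_twist half_incl_twist (twist_sqr cjK l_real lC).
apply/ffunP=> J; rewrite !ffunE valK (eqP (valP J)).
by [].
Qed.

End HalfTwist.

(** * Commutation with the group *)

Section CliffordAction.
Variables (n : nat) (A : comNzRingType) (C : algType A).
Variables (j : {linear 'rV[A]_(n + n) -> C}) (act : C -> spinor n A -> spinor n A).
Hypothesis spinor_mod : is_spinor_module j act.
Implicit Types (x y : C) (s t : spinor n A) (v : 'rV[A]_(n + n)).

Lemma act_linear x : linear (act x).
Proof. by case: spinor_mod => -[]. Qed.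

Lemma act_linear_l s : linear (act^~ s).
Proof. by case: spinor_mod => -[]. Qed.

Lemma act1 s : act 1 s = s.
Proof. by case: spinor_mod => _ []. Qed.

Lemma actM x y s : act (x * y) s = act x (act y s).
Proof. by case: spinor_mod => _ []. Qed.

Lemma actDl x y s : act (x + y) s = act x s + act y s.
Proof. exact: (linear_propD (act_linear_l s)). Qed.

Lemma act0l s : act 0 s = 0.
Proof. exact: (linear_prop0 (act_linear_l s)). Qed.

Lemma actZl c x s : act (c *: x) s = c *: act x s.
Proof. exact: (linear_propZ (act_linear_l s)). Qed.

Lemma act_vector v s : act (j v) s = vector_act v s.
Proof.
have [_ _ act_l act_r] := spinor_mod.
rewrite [v in j v]row_sum_delta linear_sum.
rewrite (big_morph (act^~ s) (fun x y => actDl x y s) (act0l s)) big_split_ord /=.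
congr (_ + _); apply: eq_bigr => i _.
  by rewrite linearZ /= actZl act_l.
by rewrite linearZ /= actZl act_r.
Qed.

(** Each vector exchanges the halves, so a product of two preserves them. *)
Lemma even_act_parity x f s : clifford_even j x ->
  act x (parity_scale f s) = parity_scale f (act x s).
Proof.
move=> even_x; elim: even_x s => {x} [c|v w|x y _ IHx _ IHy|x y _ IHx _ IHy] s.
- by rewrite !actZl !act1 linearZ.
- rewrite !actM !act_vector !vector_act_parity_scale.
  by apply/ffunP=> I; rewrite !ffunE /= negbK.
- by rewrite !actDl IHx IHy linearD.
by rewrite !actM IHy IHx.
Qed.

(** Vectors are self-adjoint, and passing to adjoints reverses products just as [tau] does. Hence
    elements of the Spin group preserve the pairing. *)
Lemma even_act_adjoint x tau s t : clifford_even j x -> is_reversal j tau ->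
  spinor_pairing (act x s) t = spinor_pairing s (act (tau x) t).
Proof.
move=> even_x [lin_tau tau1 tauM tauj].
have tauD := linear_propD lin_tau; have tauZ := linear_propZ lin_tau.
elim: even_x s t => {x} [c|v w|x y _ IHx _ IHy|x y _ IHx _ IHy] s t.
- by rewrite tauZ tau1 !actZl !act1 spinor_pairingZl spinor_pairingZr.
- by rewrite tauM !tauj !actM !act_vector !spinor_pairing_vector_act.
- by rewrite tauD !actDl spinor_pairingDl spinor_pairingDr IHx IHy.
by rewrite tauM !actM IHx IHy.
Qed.

End CliffordAction.

(** Applied with [g'] the conjugate of [g]: [H *m B] is the matrix of phi. From B^2 = 1 the
    transpose of [g] is also an isometry of [B]; substitute the transposed Hermitian relation for
    [H] in H B g. *)
Lemma isometry_intertwines (A : comNzRingType) N (B H g g' : 'M[A]_N) :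
    B *m B = 1%:M -> H^T = H -> g *m B *m g^T = B -> g *m H *m g'^T = H ->
  g' *m (H *m B) = H *m B *m g.
Proof.
move=> BB HT gB gH.
have gHT : g' *m H *m g^T = H.
  by have := congr1 trmx gH; rewrite !trmx_mul trmxK HT mulmxA.
have /mulmx1C gB1 : g *m (B *m g^T *m B) = 1%:M by rewrite !mulmxA gB BB.
have gTBg : g^T *m (B *m g) = B.
  by rewrite -[LHS]mul1mx -BB -[RHS]mulmx1 -gB1 !mulmxA.
by rewrite -[in RHS]gHT -!mulmxA gTBg.
Qed.

Definition ext_scalar (E0 : fieldType) (E : fieldExtType E0) (R : comNzRingType)
    (iota : {rmorphism E0 -> R}) : {rmorphism E0 -> extscal E iota} :=
  (GRing.in_alg (extscal E iota) \o iota)%FUN.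

Section Commutation.
Variables (E0 : fieldType) (E : fieldExtType E0) (conj : {lrmorphism E -> E}).
Hypothesis E_quadratic : \dim {:E} = 2%N.
Hypothesis conj_nontrivial : ~ conj =1 id.
Hypothesis two_neq0 : 2 != 0 :> E0.
Variables (n m : nat) (W : vectType E) (b : {symmetric W}).
Variables (psi : {hermitian_sym W for conj}) (e : (n + n).-tuple W).
Variables (a : 'I_(n + n) -> E0) (lambda q : E0).
Hypothesis n_even : n = (2 * m)%N.
Hypothesis gb : good_basis b psi e a lambda.
Hypothesis q_neq0 : q != 0.
Let n_even' := even_n n_even.
Let a_neq0 := gb_neq0 gb.
Let a_lambda := gb_lambda gb.

Local Notation coef := (twist_coef a lambda q).

Lemma tnth_decomp (k : 'I_(n + n)) :
  tnth e k = \sum_i (i == k)%:R *: tnth e i.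
Proof.
rewrite (bigD1 k) //= eqxx scale1r big1 ?addr0 // => i /negbTE->.
by rewrite scale0r.
Qed.

Lemma gram_symmetric : gram b e = block_mx 0 1%:M 1%:M 0.
Proof.
apply/matrixP=> i k; rewrite mxE (tnth_decomp i) (tnth_decomp k) (gb_sym gb).
rewrite -(splitK i) -(splitK k).
case: (split i) => {}i; case: (split k) => {}k /=;
  rewrite ?block_mxEul ?block_mxEur ?block_mxEdl ?block_mxEdr !mxE;
  under eq_bigr => r _ do rewrite ?eq_lshift ?eq_rshift ?eq_lrshift ?eq_rlshift
    ?mulr0 ?mul0r ?addr0 ?add0r.
- by rewrite big1.
- rewrite (bigD1 i) //= eqxx mul1r big1 ?addr0 // => r /negbTE->.
  by rewrite mul0r.
- rewrite (bigD1 i) //= eqxx mul1r big1 ?addr0 // => r /negbTE->.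
  by rewrite mul0r.
by rewrite big1.
Qed.

Lemma gram_hermitian : gram psi e = diag_mx (\row_k (a k)%:A).
Proof.
apply/matrixP=> i k; rewrite mxE (tnth_decomp i) (tnth_decomp k) (gb_herm gb).
rewrite !mxE (bigD1 i) //= eqxx mulr1 big1 ?addr0; last first.
  by move=> r /negbTE->; rewrite mulr0 mul0r.
by rewrite rmorph_nat mulr_natr.
Qed.

Section Points.
Variables (Omega : closedFieldType) (iota : {rmorphism E0 -> Omega}).
Local Notation A := (extscal E iota).
Local Notation cj := (@ext_map E0 E Omega iota conj).
Local Notation emb := (ext_scalar E iota).
Local Notation L := (twist cj (fun I => emb (coef I))).

Let cj_emb (z : E0) : cj (emb z) = emb z.
Proof. exact: ext_map_scalar. Qed.

Let embV (z : E0) : z != 0 -> emb z * emb z^-1 = 1.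
Proof. by move=> z0; rewrite -rmorphM divff // rmorph1. Qed.

Local Notation al := (fun i => emb (a (lshift n i))).
Local Notation ar := (fun i => emb (a (rshift n i))).

Lemma vector_twist_gram v : vector_twist cj al ar v =
  map_mx cj v *m (Omega_gram e iota psi *m Omega_gram e iota b).
Proof.
rewrite /Omega_gram gram_symmetric gram_hermitian mulmxA.
rewrite map_block_mx !map_mx0 !map_mx1 map_diag_mx.
set u := _ *m diag_mx _.
have uE k : u 0 k = emb (a k) * cj (v 0 k).
  by rewrite /u mul_mx_diag !mxE /= ext_incl_scalar mulrC.
move: u uE => u uE.
rewrite -[u]hsubmxK mul_row_block !mulmx0 !mulmx1 add0r addr0 /vector_twist.
by congr row_mx; apply/rowP=> i; rewrite !mxE uE.
Qed.

Lemma vector_twist_commutes (g : 'M[A]_(n + n)) :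
    in_SO (Omega_gram e iota b) g -> in_SU cj (Omega_gram e iota psi) g ->
  forall v, vector_twist cj al ar (v *m g) = vector_twist cj al ar v *m g.
Proof.
move=> [gB _] [gH _] v; rewrite !vector_twist_gram map_mxM.
rewrite -[LHS]mulmxA -[RHS]mulmxA; congr (_ *m _).
apply: isometry_intertwines => //.
  rewrite /Omega_gram gram_symmetric map_block_mx !map_mx0 !map_mx1.
  rewrite mulmx_block !mulmx0 !mul0mx !mulmx1 !add0r !addr0.
  by rewrite -scalar_mx_block.
by rewrite /Omega_gram gram_hermitian map_diag_mx tr_diag_mx.
Qed.

Variables (C : algType A) (j : {linear 'rV[A]_(n + n) -> C}).
Variable act : C -> spinor n A -> spinor n A.
Hypothesis spinor_mod : is_spinor_module j act.

Let cj_involutive : involutive cj.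
Proof. exact: ext_mapK (conjK E_quadratic conj_nontrivial two_neq0). Qed.

Lemma preimage_twist_sign x :
    in_preimage (Omega_gram e iota b) j cj (Omega_gram e iota psi) x ->
  (forall s, L (act x s) = act x (L s)) \/ (forall s, L (act x s) = - act x (L s)).
Proof.
move=> [[even_x [tau [rev_tau xtau taux _]]] [g [cov_g SO_g SU_g]]].
have two_inv : (emb 2^-1) *+ 2 = 1.
  by rewrite -rmorphMn -mulr_natr mulVf // rmorph1.
have embVx z : z != 0 -> exists r, emb z * r = 1.
  by move=> z0; exists (emb z^-1); apply: embV.
have [Lam0 [Lam_neq0 rel_l rel_r]] :=
  twist_coef_relations q n_even a_neq0 a_lambda.
pose Lam p := emb (Lam0 p).
have twist_l i (I : {set 'I_n}) : i \notin I -> emb (coef I) =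
    (-1) ^+ i * (al i *+ 2) * Lam (odd #|i |: I|) * emb (coef (i |: I)).
  move: (twist_coef a lambda q) rel_l => K rel_l iI.
  by rewrite (rel_l i) // !rmorphM rmorphMn rmorph_sign.
have twist_r i (I : {set 'I_n}) : i \notin I ->
    (-1) ^+ i * emb (coef (i |: I)) *+ 2 = ar i * Lam (odd #|I|) * emb (coef I).
  move: (twist_coef a lambda q) rel_r => K rel_r iI.
  by rewrite -!rmorphM -rel_r // rmorphMn rmorphM rmorph_sign.
pose mu p := emb (q ^+ 2 * 2 ^+ n * (-1) ^+ m * (\prod_(i < n) a (lshift n i))
    * lambda^-1 ^+ (m + (p : bool))).
have [c [cjc cc LX]] :
    exists c : A, [/\ cj c = c, c * c = 1 & forall s, L (act x s) = c *: act x (L s)].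
  apply: (@twist_commutes_up_to_scalar n A cj cj_involutive
    (fun I => emb (coef I)) (fun I => emb (coef I)^-1) mu Lam
    (fun p => emb (Lam0 p)^-1) (emb 2^-1) al ar n_even' two_inv
    _ _ _ _ _ _ _ twist_l twist_r (act x) (act (tau x)) g).
  - by move=> I; apply: cj_emb.
  - by move=> I; apply: embV; apply: (twist_coef_neq0 a_neq0 a_lambda).
  - by move=> I; rewrite -rmorphM (twist_coefC _ _ _ n_even).
  - by move=> p; apply: cj_emb.
  - by move=> p; apply: embV.
  - by move=> i; apply: embVx.
  - by move=> i; apply: embVx.
  - exact: (act_linear spinor_mod).
  - exact: (act_linear spinor_mod).
  - by move=> s; rewrite -(actM spinor_mod) taux (act1 spinor_mod).
  - by move=> s; rewrite -(actM spinor_mod) xtau (act1 spinor_mod).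
  - by move=> f s; apply: (even_act_parity spinor_mod).
  - by move=> s t; apply: (even_act_adjoint spinor_mod).
  - move=> v s; rewrite -!(act_vector spinor_mod) -!(actM spinor_mod).
    by rewrite cov_g.
  exact: vector_twist_commutes.
(* Now c lies in the field [Omega], so c^2 = 1 leaves only two values. *)
have [c0 cE] := ext_map_fixed E_quadratic conj_nontrivial two_neq0 cjc.
have : (c0 - 1) * (c0 + 1) = 0.
  have : (c0 * c0 - 1)%:A = 0 :> A.
    by rewrite -[LHS]/(GRing.in_alg A _) rmorphB rmorphM rmorph1 /= -cE cc subrr.
  move=> /eqP; rewrite scaler_eq0 oner_eq0 orbF => /eqP <-; ring.
move=> /eqP; rewrite mulf_eq0 subr_eq0 addr_eq0 => /orP[]/eqP c0E; [left|right] => s.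
  by rewrite LX cE c0E !scale1r.
by rewrite LX cE c0E !scaleN1r.
Qed.

Lemma twist_commutes_G1 x : in_G1 b psi e j x -> forall s, L (act x s) = act x (L s).
Proof.
move=> [Y [Y_connected Y_sub Y1 Yx]].
(* [sgn] = -1 measures the failure to commute and [sgn] = 1 the failure to anticommute. Both are
   linear over [Omega] in [y], so their vanishing is Zariski closed. *)
pose defect (sgn : A) s y := L (act y s) + sgn *: act y (L s).
have defectD sgn s y z : defect sgn s (y + z) = defect sgn s y + defect sgn s z.
  by rewrite /defect !(actDl spinor_mod) linearD scalerDr addrACA.
have defectZ sgn s (d : Omega) y :
    defect sgn s ((d%:A : A) *: y) = d%:A *: defect sgn s y.
  rewrite /defect !(actZl spinor_mod) twistZ /= ext_map_scalar.
  by rewrite scalerDr !scalerA [sgn * _]mulrC.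
pose form sgn s I k (y : C) : Omega := (defect sgn s y I : A) 0 k.
have form_linear sgn s I k : Omega_linear_form (form sgn s I k).
  split=> [y z|d y]; rewrite /form; first by rewrite defectD ffunE mxE.
  by rewrite defectZ ffunE -[_%:A *: _]/(_%:A * _ : A) mulr_algl mxE.
pose Z sgn y := forall s, defect sgn s y = 0.
have Z_closed sgn : zariski_closed (@Omega_linear_form E0 E Omega iota C) (Z sgn).
  exists (fun f => exists s I k, f = form sgn s I k); split.
    by move=> _ [s [I [k ->]]]; apply: Poly_coordinate.
  move=> y; split=> [Zy _ [s [I [k ->]]]|Zy s].
    by rewrite /form Zy ffunE mxE.
  apply/ffunP=> I; rewrite [RHS]ffunE; apply/rowP=> k; rewrite [RHS]mxE.
  by apply: (Zy (form sgn s I k)); exists s, I, k.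
have Y_cover y : Y y -> Z (-1) y \/ Z 1 y.
  move=> /Y_sub /preimage_twist_sign[LX|LX]; [left|right] => s.
    by rewrite /defect LX scaleN1r subrr.
  by rewrite /defect LX scale1r addNr.
have Y_disjoint y : Y y -> ~ (Z (-1) y /\ Z 1 y).
  move=> /Y_sub[[_ [tau [_ _ tauy _]]] _] [Zy1 Zy2].
  (* Chosen so that all coefficients of [L s] are 1; both relations together would give 2 = 0. *)
  pose s : spinor n A := [ffun I => emb (coef (~: I))^-1].
  have : act y (L s) *+ 2 = 0.
    have := Zy2 s; have := Zy1 s; rewrite /defect scaleN1r scale1r => /subr0_eq->.
    by rewrite mulr2n.
  move=> /(congr1 (act (tau y))); rewrite mulr2n.
  have lin_act := act_linear spinor_mod (tau y).
  rewrite (linear_propD lin_act) (linear_prop0 lin_act).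
  rewrite -(actM spinor_mod) tauy (act1 spinor_mod).
  move=> /ffunP/(_ set0); rewrite !ffunE setCK cj_emb embV; last first.
    by apply: (twist_coef_neq0 a_neq0 a_lambda).
  rewrite -mulr2n -(rmorph_nat emb) => /eqP.
  rewrite scaler_eq0 oner_eq0 orbF fmorph_eq0.
  by rewrite (negbTE two_neq0).
have [] := Y_connected _ _ (Z_closed (-1)) (Z_closed 1) Y_cover Y_disjoint.
  move=> /(_ x Yx) Zx s; have := Zx s; rewrite /defect scaleN1r.
  by move/subr0_eq.
move=> /(_ _ Y1) Z1; case: (Y_disjoint _ Y1).
split; last exact: Z1.
by move=> s; rewrite /defect !(act1 spinor_mod) scaleN1r subrr.
Qed.

(** Identifies the scalar extension of the operator over E with the twist over E (x) Omega: at [I]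
    only the complement of [I] contributes to the sum. *)
Lemma half_ext_map_twist (p : bool) (s : half_spinor n p A) :
  half_ext_map (half_twist conj (fun I => (coef I)%:A : E) (p := p)) s =
    half_twist cj (fun I => emb (coef I)) s.
Proof.
apply/ffunP=> I; rewrite !ffunE.
have parityI : odd #|~: val I| == p by rewrite (odd_setC n_even') (valP I).
pose I' : parity_set n p := Sub (~: val I) parityI.
have insubI : insub (~: val I) = Some I' by rewrite -[~: val I]/(val I') valK.
rewrite insubI /= (bigD1 I') //= [X in _ + X]big1 ?addr0 => [|J JI']; last first.
  rewrite big1 // => k _; rewrite !ffunE insubI /= ffunE eq_sym (negbTE JI').
  by rewrite mulr0n rmorph0 mulr0 raddf0 scaler0.
rewrite [ext_map _ _]ext_mapE mulr_sumr; apply: eq_bigr => k _.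
rewrite !ffunE insubI /= ffunE eqxx mulr1n rmorphM /= ext_incl_scalar.
by rewrite extscalAr.
Qed.

End Points.

Lemma half_twist_commutes (p : bool) :
  commutes_with_G1 b psi e (half_twist conj (fun I => (coef I)%:A : E) (p := p)).
Proof.
move=> Omega iota C j _ act spinor_mod x x_G1 s.
have even_x : clifford_even j x.
  by case: x_G1 => Y [_ Y_sub _ /Y_sub[[]]].
have half_incl_act t : half_incl (half_act act x t) = act x (half_incl t) :> spinor n _.
  rewrite half_restrK -(even_act_parity spinor_mod) //.
  by rewrite -half_restrK half_inclK.
rewrite !half_ext_map_twist /half_act half_incl_twist //.
rewrite -(twist_commutes_G1 spinor_mod x_G1) -half_incl_act -half_incl_twist //.
by rewrite !half_inclK.
Qed.

End Commutation.

(** * Normalisation of the squares *)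

Lemma imaginary_quadratic_two_neq0 (E0 : fieldType) (E : fieldExtType E0) :
  imaginary_quadratic E -> 2 != 0 :> E0.
Proof.
case=> _ [[[K [f _]] _]|[R [f _]]]; rewrite -(fmorph_eq0 f) rmorph_nat.
  by rewrite -(rmorph_nat (GRing.in_alg K)) fmorph_eq0.
by rewrite Num.Theory.pnatr_eq0.
Qed.

Lemma half_twist_exists
    (E0 : fieldType) (E : fieldExtType E0) (conj : {lrmorphism E -> E})
    (n m : nat) (W : vectType E) (b : {symmetric W})
    (psi : {hermitian_sym W for conj}) (e : (n + n).-tuple W)
    (a : 'I_(n + n) -> E0) (lambda q : E0) (p : bool) :
    imaginary_quadratic E -> ~ conj =1 id -> n = (2 * m)%N ->
    good_basis b psi e a lambda -> q != 0 ->
  exists L : {linear half_spinor n p E -> half_spinor n p E | conj \; *:%R},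
    commutes_with_G1 b psi e L /\
    forall s, L (L s) = (q ^+ 2 * 2 ^+ n * (-1) ^+ m *
      (\prod_(i < n) a (lshift n i)) * lambda^-1 ^+ (m + p))%:A *: s.
Proof.
move=> hE hconj hn gb q0; have two0 := imaginary_quadratic_two_neq0 hE.
have [dimE _] := hE.
exists (@half_twist n p E conj (fun I => (twist_coef a lambda q I)%:A)); split.
  exact: (half_twist_commutes dimE hconj two0 hn gb q0).
move=> s; pose mu (r : bool) : E := (q ^+ 2 * 2 ^+ n * (-1) ^+ m *
  (\prod_(i < n) a (lshift n i)) * lambda^-1 ^+ (m + r))%:A.
apply: (@half_twist_sqr n p E conj _ (even_n hn) mu).
- exact: conjK dimE hconj two0.
- by move=> I; rewrite /= linearZ /= rmorph1.
by move=> I; rewrite -scalerAl mul1r scalerA (twist_coefC _ _ _ hn).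
Qed.

Theorem theorem3p3
  (E0 : fieldType) (E : fieldExtType E0) (hE : imaginary_quadratic E)
  (conj : {lrmorphism E -> E}) (hconj : ~ conj =1 id)
  (n m : nat) (hn : n = (2 * m)%N)
  (W : vectType E) (b : {symmetric W}) (psi : {hermitian_sym W for conj})
  (hb : nondegenerate b) (hpsi : nondegenerate psi)
  (e : (n + n).-tuple W) (a : 'I_(n + n) -> E0) (lambda : E0)
  (he : good_basis b psi e a lambda)
  (D : E0) (hD : D = \prod_(i < n) a (lshift n i))
  (hDdet : D%:A = \det (\matrix_(i < n, k < n)
                     psi (tnth e (lshift n i)) (tnth e (lshift n k)))) :
  (exists L : {linear half_spinor n false E -> half_spinor n false E
                | conj \; *:%R},
     commutes_with_G1 b psi e L /\
     forall s, L (L s) =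
       (((-1) ^+ m * (if odd m then D * lambda else D))%:A : E) *: s) /\
  (exists L : {linear half_spinor n true E -> half_spinor n true E
                | conj \; *:%R},
     commutes_with_G1 b psi e L /\
     forall s, L (L s) =
       (((-1) ^+ m * (if odd m then D else D * lambda))%:A : E) *: s).
Proof.
have two0 := imaginary_quadratic_two_neq0 hE.
(* In q^2 the power of 2 cancels 2^n = 2^(2m), and the exponent of [lambda] is m + p rounded up to
   an even number, so one [lambda] survives when m + p is odd. *)
pose q (p : bool) : E0 := 2^-1 ^+ m * lambda ^+ (m + p).+1./2.
have lambda0 : (0 < m)%N -> lambda != 0.
  by move=> m0; apply: (lambda_neq0 (gb_neq0 he) (gb_lambda he)); rewrite hn muln_gt0.
have q0 (p : bool) : (m + p == 0)%N || (lambda != 0) -> q p != 0.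
  move=> h; apply: mulf_neq0; first by rewrite expf_neq0 // invr_eq0.
  by case/orP: h => [/eqP->|/expf_neq0->]; rewrite ?oner_neq0.
have qE (p : bool) : (m + p == 0)%N || (lambda != 0) ->
  q p ^+ 2 * 2 ^+ n * (-1) ^+ m * (\prod_(i < n) a (lshift n i)) * lambda^-1 ^+ (m + p) =
  (-1) ^+ m * (if odd (m + p) then D * lambda else D).
  move=> h; rewrite -hD /q.
  have two_pow : (2^-1 ^+ m) ^+ 2 * 2 ^+ n = 1 :> E0.
    by rewrite hn -exprM [(2 * m)%N]mulnC -exprMn mulVf // expr1n.
  have lambda_pow : (lambda ^+ (m + p).+1./2) ^+ 2 * lambda^-1 ^+ (m + p)
      = if odd (m + p) then lambda else 1.
    case/orP: h => [/eqP->|lam0]; first by rewrite !expr0 expr1n mulr1.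
    rewrite -exprM; have -> : ((m + p).+1./2 * 2 = odd (m + p) + (m + p))%N by lia.
    by rewrite exprD -mulrA -exprMn mulfV // expr1n mulr1; case: odd.
  transitivity ((-1) ^+ m * D * ((2^-1 ^+ m) ^+ 2 * 2 ^+ n) *
    ((lambda ^+ (m + p).+1./2) ^+ 2 * lambda^-1 ^+ (m + p))); first by ring.
  by rewrite two_pow lambda_pow mulr1 -mulrA; case: odd; rewrite ?mulr1.
(* For m = 0, [lambda] may vanish. The even half needs no power of [lambda]; the odd half is the
   zero space, so any operator, such as the one with [q] = 1, has the required square. *)
have [m0|m0] := posnP m; last first.
  have h p : (m + p == 0)%N || (lambda != 0) by rewrite lambda0 ?orbT.
  split.
    have [L [comL LL]] := half_twist_exists false hE hconj hn he (q0 _ (h false)).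
    by exists L; split=> // s; rewrite LL (qE _ (h _)) addn0.
  have [L [comL LL]] := half_twist_exists true hE hconj hn he (q0 _ (h true)).
  by exists L; split=> // s; rewrite LL (qE _ (h _)) addn1 /= if_neg.
have h : (m + false == 0)%N || (lambda != 0) by rewrite m0.
split.
  have [L [comL LL]] := half_twist_exists false hE hconj hn he (q0 _ h).
  by exists L; split=> // s; rewrite LL (qE _ h) addn0.
have [L [comL _]] := half_twist_exists true hE hconj hn he (oner_neq0 E0).
exists L; split=> // s; apply/ffunP=> J.
have := valP J; suff -> : #|val J| = 0%N by [].
by have := max_card (val J); have := hn; rewrite card_ord m0; lia.
Qed.
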